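(* Let $d\ge 3$ be an odd integer. The group $G_d$ is not a regular branch group; that is, there is no nontrivial subgroup $K\le G_d$ over which $G_d$ is regular branch.
   Context: Let $d\ge 3$ be odd and $X=\{1,\dots,d\}$. Let $T$ be the $d$-regular rooted tree whose vertex set is the set $X^*$ of finite words over $X$, with root the empty word, the children of $u$ being $ux$, $x\in X$; $X^k$ is the $k$-th level. $\mathrm{Aut}(T)$ is the group of root-preserving graph automorphisms of $T$, with product $gh(u)=h(g(u))$ and identity $e$. For $g\in\mathrm{Aut}(T)$ and $u\in X^*$, the section $g|_u\in\mathrm{Aut}(T)$ is determined by $g(uv)=g(u)\,g|_u(v)$ for all $v\in X^*$. The wreath recursion of $g$ is $g=(g|_1,\dots,g|_d)\lambda_g$, where $\lambda_g\in S_d$ is the permutation induced by $g$ on $X$; it determines $g$. The group $G_d\le \mathrm{Aut}(T)$ is generated by $A=\{a_1,\dots,a_d\}$, defined recursively by: for $1\le i\le d-1$, $\lambda_{a_i}=(i\ \,i+1)$, $a_i|_i=a_i$, $a_i|_{i+1}=a_{i+1}$, and $a_i|_x=e$ for all other $x\in X$; and $\lambda_{a_d}=(d\ 1)$, $a_d|_1=a_1$, $a_d|_d=a_d$, and $a_d|_x=e$ for all other $x\in X$. For $G\le\mathrm{Aut}(T)$, $\mathrm{St}_G(\widehat{1})$ is the subgroup of elements fixing every vertex of level $1$, and $\psi(g)=(g|_1,\dots,g|_d)$ for $g\in\mathrm{St}_G(\widehat{1})$. A group $G\le\mathrm{Aut}(T)$ acting transitively on each level is regular branch over a nontrivial subgroup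 $K\le G$ if $K\times\cdots\times K$ ($d$ copies) is contained in $\psi(K\cap\mathrm{St}_G(\widehat{1}))$ and $[G:K]<\infty$; $G$ is a regular branch group if it is regular branch over some such $K$. *)

(* Defs.v *)
From HB Require Import structures.
From mathcomp Require Import all_boot perm.
From mathcomp Require Import boolp classical_sets functions cardinality.

Set Implicit Arguments.
Unset Strict Implicit.
Unset Printing Implicit Defensive.

Local Open Scope group_scope.
Local Open Scope classical_set_scope.

Section AbstractGroups.
Variable gT : groupType.
Implicit Types G K : set gT.

Definition subgroup G := group_closed [in G].

Definition generated (A : set gT) : set gT := smallest subgroup A.

Definition right_cosets G K : set (set gT) :=
  [set [set k * g | k in K] | g in G].

Definition finite_index G K := finite_set (right_cosets G K).

End AbstractGroups.

Section TreeAutomorphisms.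
Variable X : Type.
Implicit Types (u v w : seq X) (x y : X).

(* The tree has vertex set [seq X]; [rcons u x] is the child of [u] written
   ux, so that the k-th level is the set of words of size k. *)
Definition adjacent u v := exists x, v = rcons u x \/ u = rcons v x.

Definition is_tree_aut (f : seq X -> seq X) :=
  [/\ bijective f, f [::] = [::]
    & forall u v, adjacent (f u) (f v) <-> adjacent u v].

Record tree_aut := TreeAut {
  tree_aut_fun :> seq X -> seq X;
  tree_autP : is_tree_aut tree_aut_fun }.

HB.instance Definition _ := gen_eqMixin tree_aut.
HB.instance Definition _ := gen_choiceMixin tree_aut.

Lemma tree_aut_ext (g h : tree_aut) : (forall u, g u = h u) -> g = h.
Proof.
case: g h => [f fP] [f' f'P] /= /funext E; subst f'.
by rewrite (Prop_irrelevance fP f'P).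
Qed.

Lemma tree_aut_inj (g : tree_aut) : injective g.
Proof. by case: (tree_autP g) => /bij_inj. Qed.

Lemma tree_aut_rcons (g : tree_aut) u x :
  exists y, g (rcons u x) = rcons (g u) y.
Proof.
case: (tree_autP g) => _ g0 gadj.
elim/last_ind: u x => [|u z IHu] x.
  have /gadj[y] : adjacent [::] [:: x] by exists x; left.
  by rewrite g0 => -[->|/(congr1 size)]; [exists y | rewrite size_rcons].
have /gadj[y [->|]] : adjacent (rcons u z) (rcons (rcons u z) x).
- by exists x; left.
- by exists y.
have [w ->] := IHu z => /rcons_inj[/tree_aut_inj/(congr1 size)].
by rewrite !size_rcons => /eqP; rewrite -addn2 -{1}[size u]addn0 eqn_add2l.
Qed.

Lemma is_tree_aut_rcons (f : seq X -> seq X) :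
    bijective f -> f [::] = [::] ->
    (forall u x, exists y, f (rcons u x) = rcons (f u) y) ->
  is_tree_aut f.
Proof.
move=> f_bij f0 frcons; split=> // u v.
have f_inj := bij_inj f_bij.
have child u1 v1 x : f v1 = rcons (f u1) x -> exists y, v1 = rcons u1 y.
  case/lastP: v1 => [|v1 z]; first by rewrite f0 => /(congr1 size); rewrite size_rcons.
  by have [y ->] := frcons v1 z => /rcons_inj[/f_inj->]; exists z.
split=> -[x [E|E]].
- by have [y ->] := child _ _ _ E; exists y; left.
- by have [y ->] := child _ _ _ E; exists y; right.
- by rewrite E; have [y ->] := frcons u x; exists y; left.
- by rewrite E; have [y ->] := frcons v x; exists y; right.
Qed.

Fact tree_aut_one_subproof : is_tree_aut id.
Proof. by split=> //; exists id. Qed.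
Definition tree_aut_one := TreeAut tree_aut_one_subproof.

(* The product is the one of right actions: [g * h] is [g] followed by [h]. *)
Fact tree_aut_mul_subproof (g h : tree_aut) : is_tree_aut (h \o g).
Proof.
case: (tree_autP g) (tree_autP h) => [gbij g0 gadj] [hbij h0 hadj].
split=> [|/=|u v /=]; first exact: bij_comp.
  by rewrite g0.
by split=> [/hadj/gadj|/gadj/hadj].
Qed.
Definition tree_aut_mul (g h : tree_aut) := TreeAut (tree_aut_mul_subproof g h).

Fact tree_aut_inv_subproof (g : tree_aut) :
  {f : seq X -> seq X | [/\ is_tree_aut f, cancel f g & cancel g f]}.
Proof.
apply: cid; case: (tree_autP g) => -[f gK fK] g0 gadj; exists f; split=> //.
split=> [||u v]; [by exists g | by rewrite -g0 gK |].
by rewrite -gadj !fK.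
Qed.
Definition tree_aut_inv (g : tree_aut) :=
  let: exist _ fP := tree_aut_inv_subproof g in
  let: And3 f_aut _ _ := fP in TreeAut f_aut.

Lemma tree_aut_invK (g : tree_aut) : cancel g (tree_aut_inv g).
Proof. by rewrite /tree_aut_inv; case: tree_aut_inv_subproof => f []. Qed.

Lemma tree_aut_Kinv (g : tree_aut) : cancel (tree_aut_inv g) g.
Proof. by rewrite /tree_aut_inv; case: tree_aut_inv_subproof => f []. Qed.

Fact tree_aut_mulA : associative tree_aut_mul.
Proof. by move=> g h k; apply: tree_aut_ext. Qed.
Fact tree_aut_mul1g : left_id tree_aut_one tree_aut_mul.
Proof. by move=> g; apply: tree_aut_ext. Qed.
Fact tree_aut_mulg1 : right_id tree_aut_one tree_aut_mul.
Proof. by move=> g; apply: tree_aut_ext. Qed.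
Fact tree_aut_mulVg : left_inverse tree_aut_one tree_aut_inv tree_aut_mul.
Proof. by move=> g; apply: tree_aut_ext => u; apply: tree_aut_Kinv. Qed.
Fact tree_aut_mulgV : right_inverse tree_aut_one tree_aut_inv tree_aut_mul.
Proof. by move=> g; apply: tree_aut_ext => u; apply: tree_aut_invK. Qed.

HB.instance Definition _ := isGroup.Build tree_aut
  tree_aut_mulA tree_aut_mul1g tree_aut_mulg1 tree_aut_mulVg tree_aut_mulgV.

Lemma tree_aut1E u : (1 : tree_aut) u = u.
Proof. by []. Qed.

Lemma tree_autME (g h : tree_aut) u : (g * h) u = h (g u).
Proof. by []. Qed.

Lemma size_tree_aut (g : tree_aut) u : size (g u) = size u.
Proof.
elim/last_ind: u => [|u x IHu]; first by case: (tree_autP g) => _ ->.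
by have [y ->] := tree_aut_rcons g u x; rewrite !size_rcons IHu.
Qed.

Definition section_fun (g : tree_aut) u v := drop (size u) (g (u ++ v)).

Lemma section_funE (g : tree_aut) u v : g (u ++ v) = g u ++ section_fun g u v.
Proof.
suff [w E] : exists w, g (u ++ v) = g u ++ w.
  by rewrite /section_fun E -(size_tree_aut g u) drop_size_cat.
elim/last_ind: v => [|v x [w E]]; first by exists [::]; rewrite !cats0.
have [y Ey] := tree_aut_rcons g (u ++ v) x.
by exists (rcons w y); rewrite -rcons_cat Ey E rcons_cat.
Qed.

Fact section_subproof (g : tree_aut) u : is_tree_aut (section_fun g u).
Proof.
have [[f gK fK] _ _] := tree_autP g.
apply: is_tree_aut_rcons.
- exists (fun w => drop (size u) (f (g u ++ w))) => v.
    by rewrite -section_funE gK drop_size_cat.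
  rewrite /section_fun; set z := f (g u ++ v).
  have gz : g z = g u ++ v by rewrite fK.
  have szz : size u <= size z.
    by rewrite -(size_tree_aut g z) gz size_cat size_tree_aut leq_addr.
  have /tree_aut_inj tz : g (take (size u) z) = g u.
    have := gz; rewrite -{1}(cat_take_drop (size u) z) section_funE.
    move/(congr1 (take (size u))); rewrite !take_size_cat ?size_tree_aut //.
    by rewrite size_takel.
  by rewrite -{2}tz cat_take_drop gz drop_size_cat ?size_tree_aut.
- by rewrite /section_fun cats0 drop_oversize ?size_tree_aut.
- move=> v x; have [y E] := tree_aut_rcons g (u ++ v) x; exists y.
  rewrite /section_fun -rcons_cat E drop_rcons //.
  by rewrite size_tree_aut size_cat leq_addr.
Qed.

Definition section (g : tree_aut) u : tree_aut :=
  TreeAut (section_subproof g u).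

Lemma sectionE (g : tree_aut) u v : g (u ++ v) = g u ++ section g u v.
Proof. exact: section_funE. Qed.

Implicit Types G K : set tree_aut.

Definition level_transitive G :=
  forall k u v, size u = k -> size v = k -> exists2 g, G g & g u = v.

Definition level1_stab G : set tree_aut :=
  [set g | G g /\ forall u, size u = 1%N -> g u = u].

Definition psi (g : tree_aut) : X -> tree_aut := fun x => section g [:: x].

Definition regular_branch_over G K :=
  [/\ level_transitive G,
      subgroup K /\ K `<=` G,
      K <> [set 1],
      [set k : X -> tree_aut | forall x, K (k x)]
        `<=` psi @` (K `&` level1_stab G)
    & finite_index G K].

Definition regular_branch G := exists K, regular_branch_over G K.

End TreeAutomorphisms.

Section TheGroup.
Variable d : nat.
Implicit Types (i x : 'I_d) (v : seq 'I_d).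

(* Letters and generators are indexed by {0, ..., d - 1} and [ordS] is the
   cyclic successor, so the last generator is not a special case. *)
Fixpoint gen_fun i v : seq 'I_d :=
  if v is x :: v' then
    tperm i (ordS i) x ::
      (if x == i then gen_fun i v'
       else if x == ordS i then gen_fun (ordS i) v' else v')
  else [::].

Fixpoint gen_inv i v : seq 'I_d :=
  if v is y :: v' then
    let x := tperm i (ordS i) y in
    x :: (if x == i then gen_inv i v'
          else if x == ordS i then gen_inv (ordS i) v' else v')
  else [::].

Fact gen_subproof i : is_tree_aut (gen_fun i).
Proof.
apply: is_tree_aut_rcons => //.
  exists (gen_inv i) => v; elim: v i => //= x v IHv i.
    rewrite tpermK; congr (_ :: _).
    by case: eqP => // _; case: eqP.
  rewrite tpermK; congr (_ :: _).
  by case: eqP => // _; case: eqP.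
move=> u x; elim: u i => [|y u IHu] i /=.
  by exists (tperm i (ordS i) x); do 2?case: eqP => //.
have [z1 ->] := IHu i; have [z2 ->] := IHu (ordS i).
by case: eqP => _; [exists z1 | case: eqP => _; [exists z2 | exists x]].
Qed.

Definition gen i : tree_aut 'I_d := TreeAut (gen_subproof i).

Lemma gen_letter i x : gen i [:: x] = [:: tperm i (ordS i) x].
Proof. by rewrite /=; do 2?case: eqP => //. Qed.

Lemma gen_section i x :
  section (gen i) [:: x] =
    if x == i then gen i else if x == ordS i then gen (ordS i) else 1.
Proof.
apply: tree_aut_ext => v; rewrite /= /section_fun /= drop0.
by case: eqP => // _; case: eqP.
Qed.

Definition Gd : set (tree_aut 'I_d) := generated (range gen).

End TheGroup.

Arguments Gd : clear implicits.

(* Main.v *)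
Require Import Defs.
From mathcomp Require Import all_boot.
From mathcomp Require Import all_algebra perm zify.
From mathcomp Require Import boolp classical_sets cardinality.

Set Implicit Arguments.
Unset Strict Implicit.
Unset Printing Implicit Defensive.

Import GRing.Theory.

(** Everything rests on the exponent sum of a word in the generators and
    their inverses, which is shown to depend only on the element of [Gd d]
    that the word spells; it is thus a homomorphism tau onto the integers.

    Each generator swaps two letters and has a generator as section at these
    two and the trivial section elsewhere.  Hence a word [w] induces, by
    concatenating the sections of its letters along the orbit of [x], a word
    [word_section w x] that spells the section at [x], and each letter of [w]
    contributes exactly one letter, of the same sign, to exactly two of these
    words.  So the exponent sums of the sections of [w] add up to twice the
    exponent sum of [w] ([sum_expsum_section]), and likewise for lengths
    ([sum_size_section]).

    Homomorphism: suppose that some word spells 1 with nonzero exponent sum.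
    Take such a [w] of least length and, for this length, of greatest
    absolute exponent sum T ([extremal]).  Its sections spell 1, so those
    shorter than [w] have exponent sum 0 and the others at most T in absolute
    value.  As they add up to 2T, and the lengths allow at most two sections as
    long as [w], there are exactly two of them, and these have absolute
    exponent sum T ([extremal_full]); in particular they are extremal too.
    When two letters are moved by every step of a word, that word is written
    with a single generator and its inverse ([two_full_single]).  This
    applies to an extremal section [word_section w x] of [w], and it makes the
    exponent sum of [w] telescope along the orbit of [x], which is closed:
    the sum is 0, a contradiction ([not_extremal], [expsum_trivial]).

    Branching: let [Gd d] be regular branch over [K].  Since [K] has finite
    index, it contains a positive power of a generator, so tau is not zero on
    [K].  For [k] in [K], the tuple (k, 1, ..., 1) is psi of some [g] in [K],
    and then tau k = 2 tau g.  So every value of tau on [K] is twice a value of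
    tau on [K], which infinite descent excludes. *)

Local Open Scope group_scope.

(** * Sections of products and inverses *)

Section Sections.
Variable X : Type.
Implicit Types (g h : tree_aut X) (u v : seq X).

Lemma section_mul g h u : section (g * h) u = section g u * section h (g u).
Proof.
apply: tree_aut_ext => v; rewrite tree_autME.
have := sectionE (g * h) u v.
rewrite !tree_autME (sectionE g) (sectionE h) => /(congr1 (drop (size u))).
by rewrite !drop_size_cat ?size_tree_aut.
Qed.

Lemma section1 u : section (1 : tree_aut X) u = 1.
Proof. by apply: tree_aut_ext => v; rewrite /= /section_fun /= drop_size_cat. Qed.

Lemma section_inv g u : section g^-1 u = (section g (g^-1 u))^-1.
Proof.
have := section_mul g^-1 g u; rewrite mulVg section1.
by move/(congr1 (fun h => h * (section g (g^-1 u))^-1)); rewrite mul1g mulgK.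
Qed.

End Sections.

(** * Words in the generators and their sections *)

Section Words.
Variable d : nat.
Implicit Types (i j x y : 'I_d) (l : 'I_d * bool) (w v : seq ('I_d * bool)).

(** The letter [(i, b)] stands for the generator [gen i] if [b] is true and for
    its inverse otherwise. *)
Definition letter_val l : tree_aut 'I_d := if l.2 then gen l.1 else (gen l.1)^-1.
Definition word_val w : tree_aut 'I_d := foldr (fun l g => letter_val l * g) 1 w.

Definition letter_exp (b : bool) : int := if b then 1%R else (-1)%R.
Definition expsum w : int := (\sum_(l <- w) letter_exp l.2)%R.

Definition swap i x := tperm i (ordS i) x.
Definition moves i x := (x == i) || (x == ordS i).
Definition word_act w x := foldl (fun y l => swap l.1 y) x w.

(** The inverse of [gen i] takes [x] to [swap i x], so its section at [x] is
    the inverse of the section of [gen i] at [swap i x], not at [x]. *)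
Definition letter_section l x : seq ('I_d * bool) :=
  if moves l.1 x then [:: (if l.2 then x else swap l.1 x, l.2)] else [::].

Fixpoint word_section w x :=
  if w is l :: w' then letter_section l x ++ word_section w' (swap l.1 x)
  else [::].

Definition word_inv w := rev [seq (l.1, ~~ l.2) | l <- w].

Lemma swapK i : involutive (swap i).
Proof. exact: tpermK. Qed.

Lemma moves_swap i x : moves i (swap i x) = moves i x.
Proof.
rewrite /moves /swap; case: tpermP => [->|->|//]; by rewrite !eqxx orbT.
Qed.

Lemma letter_val_letter l x : letter_val l [:: x] = [:: swap l.1 x].
Proof.
rewrite /letter_val; case: l.2; first exact: gen_letter.
apply: (@tree_aut_inj _ (gen l.1)); rewrite gen_letter -/(swap _ _) swapK.
exact: tree_aut_Kinv.
Qed.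

Lemma word_val_letter w x : word_val w [:: x] = [:: word_act w x].
Proof.
elim: w x => [|l w IHw] x //.
by rewrite [word_val _]/= tree_autME letter_val_letter IHw.
Qed.

Lemma word_val_cat w v : word_val (w ++ v) = word_val w * word_val v.
Proof. by elim: w => /= [|l w ->]; rewrite ?mul1g ?mulgA. Qed.

Lemma word_val_inv w : word_val (word_inv w) = (word_val w)^-1.
Proof.
elim: w => [|[i b] w IHw]; first by rewrite /= invg1.
rewrite /word_inv /= rev_cons -cats1 word_val_cat [X in X * _]IHw /= mulg1.
by rewrite /letter_val /=; case: b; rewrite invgM ?invgK.
Qed.

Lemma word_val_nseq l n : word_val (nseq n l) = letter_val l ^+ n.
Proof. by elim: n => //= n ->; rewrite expgS. Qed.

Lemma section_gen i x :
  section (gen i) [:: x] = if moves i x then gen x else 1.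
Proof.
rewrite gen_section /moves; case: eqP => [->|_] //=.
by case: eqP => [->|_].
Qed.

Lemma section_letter_val l x :
  section (letter_val l) [:: x] = word_val (letter_section l x).
Proof.
rewrite /letter_val /letter_section; case: l => i [] /=.
  by rewrite section_gen; case: ifP => //= _; rewrite mulg1.
rewrite section_inv -[_ [:: x]]/(letter_val (i, false) [:: x]).
rewrite letter_val_letter section_gen moves_swap.
by case: ifP => _ /=; rewrite ?mulg1 ?invg1.
Qed.

Lemma section_word_val w x :
  section (word_val w) [:: x] = word_val (word_section w x).
Proof.
elim: w x => [|l w IHw] x /=; first exact: section1.
by rewrite section_mul section_letter_val letter_val_letter IHw word_val_cat.
Qed.

Lemma trivial_section w x : word_val w = 1 -> word_val (word_section w x) = 1.
Proof. by rewrite -section_word_val => ->; rewrite section1. Qed.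

Lemma trivial_act w x : word_val w = 1 -> word_act w x = x.
Proof. by move=> w1; have := word_val_letter w x; rewrite w1 => -[]. Qed.

(** * Exponent sums and lengths of sections *)

Lemma expsum_cons l w : expsum (l :: w) = (letter_exp l.2 + expsum w)%R.
Proof. by rewrite /expsum big_cons. Qed.

Lemma expsum_cat w v : expsum (w ++ v) = (expsum w + expsum v)%R.
Proof. by rewrite /expsum big_cat. Qed.

Lemma expsum_inv w : expsum (word_inv w) = (- expsum w)%R.
Proof.
elim: w => [|[i b] w IHw]; first by rewrite /expsum !big_nil.
rewrite /word_inv /= rev_cons -cats1 expsum_cat [X in (X + _)%R]IHw !expsum_cons.
by rewrite /expsum big_nil /letter_exp /=; case: b => /=; lia.
Qed.

Lemma expsum_nseq l n : expsum (nseq n l) = (letter_exp l.2 *+ n)%R.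
Proof.
elim: n => [|n IHn] /=; first by rewrite /expsum big_nil.
by rewrite expsum_cons IHn mulrS.
Qed.

Lemma abs_expsum_le w : (`|expsum w| <= size w)%N.
Proof.
elim: w => [|l w IHw] /=; first by rewrite /expsum big_nil.
by rewrite expsum_cons /letter_exp; case: l.2; lia.
Qed.

Lemma size_letter_section l x : size (letter_section l x) = moves l.1 x.
Proof. by rewrite /letter_section; case: ifP. Qed.

Lemma size_word_section w x : size (word_section w x) <= size w.
Proof.
elim: w x => //= l w IHw x; rewrite size_cat size_letter_section.
by have := IHw (swap l.1 x); case: moves => /=; lia.
Qed.

Lemma val_ordS i : val (ordS i) = if i.+1 == d then 0 else i.+1.
Proof.
rewrite /=; case: eqP => [->|/eqP ne]; first exact: modnn.
by rewrite modn_small // ltn_neqAle ne ltn_ord.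
Qed.

Lemma ordS_neq i : 1 < d -> ordS i != i.
Proof. by move=> d1; rewrite -val_eqE val_ordS; case: (i.+1 =P d) => /= ?; lia. Qed.

(** This is where [d] has to be at least 3: two letters are swapped by at most
    one generator. *)
Lemma ordSS_neq i : 2 < d -> ordS (ordS i) != i.
Proof.
move=> d2; rewrite -val_eqE !val_ordS.
by case: (i.+1 =P d) => /= ?; case: ifP => /= ?; lia.
Qed.

Lemma card_moves i : 1 < d -> #|[pred x | moves i x]| = 2.
Proof.
move=> d1; rewrite (eq_card (B := pred2 i (ordS i))) //.
by rewrite card2 eq_sym ordS_neq.
Qed.

Lemma sum_moves (V : nmodType) i (a : V) :
  1 < d -> (\sum_x (if moves i x then a else 0) = a *+ 2)%R.
Proof.
by move=> d1; rewrite -big_mkcond /= sumr_const card_moves.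
Qed.

(** Exponent sum and length are both of this form: each letter of the word is
    read by exactly two of the sections, and its contribution depends only on
    its sign, which sections preserve. *)
Lemma sum_word_section (V : nmodType) (f : seq ('I_d * bool) -> V) (c : bool -> V) :
    1 < d -> f [::] = 0%R ->
    (forall l w, f (l :: w) = c l.2 + f w)%R ->
  forall w, (\sum_x f (word_section w x) = f w *+ 2)%R.
Proof.
move=> d1 f0 fS; elim=> [|l w IHw] /=.
  by rewrite f0 mul0rn big1.
(* After the first letter, the word is read from [swap l.1 x], which runs over
   all letters when [x] does. *)
rewrite fS mulrnDl -(sum_moves l.1 (c l.2) d1) -IHw.
rewrite [X in (_ = _ + X)%R](reindex_inj (inv_inj (swapK l.1))) -big_split.
apply: eq_bigr => x _; rewrite /letter_section.
by case: ifP => _ /=; rewrite ?fS ?add0r.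
Qed.

Lemma sum_expsum_section w : 1 < d ->
  (\sum_x expsum (word_section w x) = expsum w *+ 2)%R.
Proof.
move=> d1; apply: (sum_word_section (c := letter_exp) d1).
  by rewrite /expsum big_nil.
by move=> l v; rewrite expsum_cons.
Qed.

Lemma sum_size_section w : 1 < d ->
  (\sum_x size (word_section w x) = (size w).*2)%N.
Proof.
move=> d1; rewrite -muln2 mulnC.
have := sum_word_section (V := nat) (f := size) (c := fun=> 1%N) d1 erefl.
by move/(_ (fun _ _ => erefl))/(_ w); rewrite mulr2n mul2n -addnn.
Qed.

(** * Exponent sums of trivial words *)

(** Every step of [w] moves the letter it meets on the orbit of [x]. *)
Definition full w x := size (word_section w x) == size w.

Lemma full_cons l w x : full (l :: w) x = moves l.1 x && full w (swap l.1 x).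
Proof.
rewrite /full /= size_cat size_letter_section.
have := size_word_section w (swap l.1 x).
by case: moves => /=; lia.
Qed.

(** A generator that moves both [i] and [ordS i] is [gen i], and it swaps the
    two; so a pair of letters moved by every step stays the same pair, and
    always calls for the same generator. *)
Lemma two_full_single w x y : 2 < d ->
    x != y -> full w x -> full w y ->
  exists i, all (fun l => l.1 == i) w.
Proof.
move=> d3.
have aux i v : full v i -> full v (ordS i) -> all (fun l => l.1 == i) v.
  elim: v => //= l v IHv; rewrite !full_cons => /andP[m1 f1] /andP[m2 f2].
  have il : l.1 = i.
    move: m1 m2; rewrite /moves => /orP[/eqP//|/eqP E] /orP[/eqP F|/eqP F].
      by have := ordSS_neq l.1 d3; rewrite -E F eqxx.
    by have := ordS_neq i (ltnW d3); rewrite F E eqxx.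
  rewrite il eqxx IHv //; move: f1 f2; rewrite il /swap.
    by rewrite tpermR.
  by rewrite tpermL.
case: w => [|l w]; first by exists x.
move=> xy fx fy; exists l.1.
have [mx my] : moves l.1 x /\ moves l.1 y.
  by move: fx fy; rewrite !full_cons => /andP[-> _] /andP[-> _].
move: mx my xy fx fy => /orP[/eqP->|/eqP->] /orP[/eqP->|/eqP->].
- by rewrite eqxx.
- by move=> _ fx fy; apply: aux.
- by move=> _ fx fy; apply: aux.
- by rewrite eqxx.
Qed.

(** A positive step at [x] puts the generator indexed by the departure point
    into the section, a negative one the generator indexed by the arrival point.
    If that index is always [j], positive steps leave [j] and negative steps
    reach [j], so the exponent sum telescopes. *)
Lemma single_section_expsum w x j :
    1 < d -> full w x -> all (fun l => l.1 == j) (word_section w x) ->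
  expsum w = ((word_act w x != j)%:R - (x != j)%:R)%R.
Proof.
move=> d1; elim: w x => [|[i b] w IHw] x; first by rewrite /expsum big_nil subrr.
rewrite full_cons => /andP[/= mx fx]; rewrite /letter_section mx /=.
case/andP=> /eqP xj /(IHw _ fx); rewrite expsum_cons => ->.
have sx : swap i x != x.
  have := ordS_neq i d1; case/orP: mx => /eqP->.
    by rewrite /swap tpermL.
  by rewrite /swap tpermR eq_sym.
move: sx xj; rewrite /letter_exp; case: b => /= nx xj.
  by rewrite -xj eqxx nx; lia.
by rewrite -xj eqxx [x == _]eq_sym nx; lia.
Qed.

(** A counterexample to the vanishing of exponent sums of trivial words, of
    least length and then of greatest absolute exponent sum. *)
Definition extremal w :=
  [/\ word_val w = 1, expsum w != 0%R,
      forall v, size v < size w -> word_val v = 1 -> expsum v = 0%R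
    & forall v, size v = size w -> word_val v = 1 ->
        (`|expsum v| <= `|expsum w|)%N].

(** The sections of full length carry the whole sum 2T, with at most T each,
    so there are at least two of them; the total length 2|w| leaves room for no
    third, so each carries exactly T up to sign. *)
Lemma extremal_full w : 1 < d -> extremal w ->
  exists x y, [/\ x != y, full w x, full w y
    & `|expsum (word_section w x)|%N = `|expsum w|%N].
Proof.
move=> d1 [w1 w0 w_short w_max].
pose F := [set x | full w x].
have sumF : (\sum_(x in F) expsum (word_section w x) = expsum w *+ 2)%R.
  rewrite -(sum_expsum_section w d1) [RHS](bigID (mem F)) /=.
  rewrite [X in (_ = _ + X)%R]big1 ?addr0 // => x; rewrite inE => nf.
  apply: w_short; last exact: trivial_section.
  by rewrite ltn_neqAle size_word_section andbT.
have maxF x : x \in F -> (`|expsum (word_section w x)| <= `|expsum w|)%N.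
  by rewrite inE => /eqP fx; apply: w_max => //; apply: trivial_section.
have leF : (#|F| * size w <= (size w).*2)%N.
  rewrite -(sum_size_section w d1) [leqRHS](bigID (mem F)) /=.
  apply: leq_trans (leq_addr _ _); rewrite -sum_nat_const; apply: leq_sum => x.
  by rewrite inE => /eqP->.
have geF : ((`|expsum w|).*2 <= #|F| * `|expsum w|)%N.
  rewrite -sum_nat_const.
  apply: (@leq_trans (\sum_(x in F) `|expsum (word_section w x)|)); last first.
    exact: leq_sum maxF.
  have -> : (`|expsum w|.*2 = `|(expsum w *+ 2)%R|)%N by lia.
  rewrite -sumF; elim/big_rec2: _ => [|x m z _]; lia.
have w_gt0 := abs_expsum_le w.
have /cards2P[x [y [xy defF]]] : #|F| == 2.
  by apply/eqP; nia.
have [fx fy] : x \in F /\ y \in F by rewrite defF !inE !eqxx orbT.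
exists x, y; split=> //; [by move: fx; rewrite inE | by move: fy; rewrite inE |].
have [mx my] := (maxF _ fx, maxF _ fy).
by move: sumF; rewrite defF big_setU1 ?inE //= big_set1; lia.
Qed.

(** A full section of an extremal word is again extremal, hence has two full
    sections itself, so [single_section_expsum] applies to the original word. *)
Lemma not_extremal w : 2 < d -> ~ extremal w.
Proof.
move=> d3 ext_w; have d1 := ltnW d3.
have [x [_ [_ fx _ Ex]]] := extremal_full d1 ext_w.
case: (ext_w) => w1 w0 w_short w_max.
have ext_wx : extremal (word_section w x).
  split; rewrite ?(eqP fx) ?Ex //; first exact: trivial_section.
  by rewrite -absz_eq0 Ex absz_eq0.
have [y [z [yz fy fz _]]] := extremal_full d1 ext_wx.
have [j wj] := two_full_single d3 yz fy fz.
by case/eqP: w0; rewrite (single_section_expsum d1 fx wj) trivial_act // subrr.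
Qed.

(** Any counterexample leads to an extremal one: absolute exponent sums are
    bounded by the length [n], so [n - |expsum w|] can serve as a measure. *)
Lemma expsum_trivial w : 2 < d -> word_val w = 1 -> expsum w = 0%R.
Proof.
move=> d3; move: {2}(size w) (leqnn (size w)) => n.
elim/ltn_ind: n w => n IHn w.
have [m] := ubnP (n - `|expsum w|)%N.
elim: m w => // m IHm w wm wn w1.
have IHs v : size v < n -> word_val v = 1 -> expsum v = 0%R.
  by move=> vn; apply: IHn vn _ _.
have [/IHs/(_ w1)//|nw] := ltnP (size w) n.
have [//|w0] := eqVneq (expsum w) 0%R.
case: (@not_extremal w d3); split=> // [v vw|v vw v1].
  by apply: IHs; lia.
rewrite leqNgt; apply/negP => ltv.
have := abs_expsum_le v; have := IHm v.
move=> /[swap] ? /(_ _ _ v1) E; have : expsum v = 0%R by apply: E; lia.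
lia.
Qed.

Lemma expsum_eq w v : 2 < d -> word_val w = word_val v -> expsum w = expsum v.
Proof.
move=> d3 wv; have := @expsum_trivial (w ++ word_inv v) d3.
rewrite word_val_cat word_val_inv wv mulgV expsum_cat expsum_inv.
by move=> /(_ erefl)/eqP; rewrite subr_eq0 => /eqP.
Qed.

End Words.

(** * Finite index and the descent *)

Local Open Scope classical_set_scope.

Lemma Gd_word d g : Gd d g -> exists w, g = word_val w.
Proof.
move=> Gg; pose W : set (tree_aut 'I_d) := [set h | exists w, h = word_val w].
suff WG : subgroup W.
  apply: (smallest_sub WG _ Gg) => _ [i _ <-].
  by exists [:: (i, true)]; rewrite /= mulg1.
split=> [|h1 h2]; rewrite !inE /=; first by exists [::].
move=> [v ->] [w ->]; exists (v ++ word_inv w).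
by rewrite word_val_cat word_val_inv.
Qed.

Lemma gen_in_Gd d (i : 'I_d) : Gd d (gen i).
Proof. by apply: sub_gen_smallest; exists i. Qed.

Lemma subgroup_generated (gT : groupType) (A : set gT) : subgroup (generated A).
Proof.
split=> [|g h]; first by rewrite inE => H [[]]; rewrite inE.
rewrite !inE => gA hA H HA; have := gA H HA; have := hA H HA.
by case: HA => [[_ Hdiv] _] hH gH; have := Hdiv g h; rewrite !inE; apply.
Qed.

(** The cosets of the powers of [g] cannot be pairwise distinct, and the
    quotient of two powers in the same coset lies in [K]. *)
Lemma finite_index_pow (gT : groupType) (G K : set gT) g :
    subgroup G -> subgroup K -> finite_index G K -> G g ->
  exists2 n, 0 < n & K (g ^+ n).
Proof.
move=> sG sK fin Gg; apply: contrapT => noK.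
pose f n := [set k * g ^+ n | k in K].
have K1 : K 1 by case: sK; rewrite inE.
have GX n : G (g ^+ n).
  elim: n => [|n IHn]; first by case: sG; rewrite inE.
  by rewrite expgS -in_setE; apply: (group_closedM sG); rewrite inE.
have f_inj : injective f.
  suff lt m n : m < n -> f m <> f n.
    by move=> m n fE; case: (ltngtP m n) => // /lt; rewrite fE.
  move=> mn fE; apply: noK; exists (n - m)%N; first by rewrite subn_gt0.
  have [k Kk kE] : f m (g ^+ n) by rewrite fE; exists 1 => //; rewrite mul1g.
  suff -> : g ^+ (n - m) = k by [].
  by apply: (mulIg (g ^+ m)); rewrite kE -expgnDr subnK // ltnW.
apply: infinite_nat; rewrite -(_ : f @^-1` right_cosets G K = [set: nat]).
  by apply: finite_preimage => // m n _ _; apply: f_inj.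
by apply/seteqP; split=> // n _; exists (g ^+ n).
Qed.

Theorem corollary4p7 (d : nat) (hd : 3 <= d) (hodd : odd d) :
  ~ regular_branch (Gd d).
Proof.
case=> K [_ [sK KG] _ brK finK].
have d1 : 1 < d := ltnW hd; pose o := Ordinal (ltnW d1).
have [n n_gt0 Kn] := finite_index_pow (@subgroup_generated _ _) sK finK (gen_in_Gd o).
have K1 : K 1 by case: sK; rewrite inE.
(* Descent on the absolute exponent sum over the words that spell elements of
   [K]. *)
suff main m w : `|expsum w|%N < m -> K (word_val w) -> expsum w = 0%R.
  have := main _ (nseq n (o, true)) (ltnSn _).
  rewrite word_val_nseq expsum_nseq => /(_ Kn) /=; rewrite /letter_exp /=; lia.
elim: m w => // m IHm w wm Kw; apply/eqP/negP => /negP w0.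
pose k (x : 'I_d) := if x == o then word_val w else 1.
have [|g [Kg _] gk] := brK k; first by move=> x /=; rewrite /k; case: ifP.
have [v gv] := Gd_word (KG _ Kg).
have secv x : expsum (word_section v x) = if x == o then expsum w else 0%R.
  have : word_val (word_section v x) = k x.
    by rewrite -section_word_val -gv -gk.
  rewrite /k; case: ifP => _ E; first exact: expsum_eq.
  exact: expsum_trivial.
have := sum_expsum_section v d1; rewrite (eq_bigr _ (fun x _ => secv x)).
rewrite -big_mkcond big_pred1_eq => Ewv.
have : expsum v = 0%R by apply: IHm; [lia | rewrite -gv].
by move=> v0; move: w0; rewrite Ewv v0 eqxx.
Qed.
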